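(* $\mathsf{RCOH}$ is omnisciently computably reducible to $\mathsf{RT}^1_2$. That is: for every sequence $\vec{R} = \langle R_0, R_1, \ldots\rangle$ of subsets of $\omega$ there exists a coloring $c : \omega \to 2$ such that for every infinite homogeneous set $H$ for $c$, the set $\vec{R} \oplus H$ computes an infinite Ramsey-cohesive set for $\vec{R}$.
   Context: A problem is a relation $\mathsf{P} \subseteq 2^\omega\times 2^\omega$; $X$ is an instance if $\mathsf{P}(X,Y)$ holds for some $Y$, and each such $Y$ is a solution to $X$. A problem $\mathsf{P}$ is omnisciently computably reducible to a problem $\mathsf{Q}$ if for every instance $X$ of $\mathsf{P}$ there exists an instance $\widehat{X}$ of $\mathsf{Q}$ (not required to be computable from $X$) such that for every solution $\widehat{Y}$ to $\widehat{X}$, $X \oplus \widehat{Y}$ computes a solution to $X$. Here $2=\{0,1\}$, and sequences of sets are coded as single sets in the standard way. $\mathsf{RT}^1_2$: instances are colorings $c:\omega\to 2$; solutions are infinite homogeneous sets, i.e. infinite $H\subseteq\omega$ with $c$ constant on $H$. Write $X \subseteq^* Y$ if $X\setminus F\subseteq Y$ for some finite set $F$. A set $C$ is Ramsey-cohesive for $\vec{R}$ if for infinitely many $n\in\omega$, either $C \subseteq^* R_n$ or $C \subseteq^* \overline{R}_n$ (complement in $\omega$). $\mathsf{RCOH}$: instances are sequences $\vec{R}$ of subsets of $\omega$; solutions are the infinite Ramsey-cohesive sets for $\vec{R}$. *)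

(* Defs.v *)
From mathcomp Require Import all_boot.
From mathcomp Require Import boolp classical_sets functions cardinality.
From Stdlib Require Cantor.

Set Implicit Arguments.
Unset Strict Implicit.
Unset Printing Implicit Defensive.

Local Open Scope classical_set_scope.

(* Points of Cantor space; X is identified with the set [set n | X n]. *)
Definition cantor := nat -> bool.

Definition elts (X : cantor) : set nat := [set n | X n].

(* Kleene's definition of the functions partial recursive in an oracle:        *)
(* code k is the type of k-ary programs, built from the basic functions by     *)
(* composition, primitive recursion and unbounded search.                      *)
Inductive code : nat -> Type :=
| Zero k : code k
| Succ : code 1
| Oracle : code 1
| Proj k : 'I_k -> code k
| Comp k m : code m -> ('I_m -> code k) -> code k
| Prec k : code k -> code k.+2 -> code k.+1
| Mu k : code k.+1 -> code k.

(* eval X e v y: the program e with oracle X halts on input v with output y.   *)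
(* In the Prec case, w i is the value of the recursion at i.                   *)
Fixpoint eval (X : cantor) k (e : code k) : k.-tuple nat -> nat -> Prop :=
  match e in code k return k.-tuple nat -> nat -> Prop with
  | Zero _ => fun _ y => y = 0
  | Succ => fun v y => y = (thead v).+1
  | Oracle => fun v y => y = X (thead v)
  | Proj _ i => fun v y => y = tnth v i
  | Comp _ m f g => fun v y =>
      exists w : m.-tuple nat,
        (forall i, eval X (g i) v (tnth w i)) /\ eval X f w y
  | Prec _ f g => fun v y =>
      exists w : nat -> nat,
        [/\ eval X f [tuple of behead v] (w 0),
            forall i, i < thead v ->
              eval X g [tuple of [:: i, w i & behead v]] (w i.+1)
          & y = w (thead v)]
  | Mu _ f => fun v y =>
      eval X f [tuple of y :: v] 0 /\
      forall i, i < y -> exists z, eval X f [tuple of i :: v] z.+1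
  end.

Definition computes (X Y : cantor) : Prop :=
  exists e : code 1, forall n, eval X e [tuple n] (Y n).

Definition join (X Y : cantor) : cantor :=
  fun n => if odd n then Y n./2 else X n./2.

(* A sequence of sets is coded by the single set of pairs <n, x> with x in     *)
(* R n, where <n, x> is Cantor's pairing function.                             *)
Definition seq_code (R : nat -> cantor) : cantor :=
  fun z => R (Cantor.of_nat z).1 (Cantor.of_nat z).2.

Definition seq_nth (X : cantor) (n : nat) : cantor :=
  fun x => X (Cantor.to_nat (n, x)).

Lemma seq_codeK : cancel seq_code seq_nth.
Proof.
move=> R; apply/funext => n; apply/funext => x.
by rewrite /seq_nth /seq_code Cantor.cancel_of_to.
Qed.

Lemma seq_nthK : cancel seq_nth seq_code.
Proof.
move=> X; apply/funext => z.
by rewrite /seq_nth /seq_code -surjective_pairing Cantor.cancel_to_of.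
Qed.

Definition problem := cantor -> cantor -> Prop.

Definition is_instance (P : problem) (X : cantor) : Prop := exists Y, P X Y.

Definition omnisciently_computably_reducible (P Q : problem) : Prop :=
  forall X, is_instance P X ->
    exists X', is_instance Q X' /\
      forall Y', Q X' Y' -> exists Y, P X Y /\ computes (join X Y') Y.

Definition homogeneous (c : nat -> bool) (H : cantor) : Prop :=
  exists i : bool, forall x, H x -> c x = i.

Definition RT12 : problem :=
  fun c H => infinite_set (elts H) /\ homogeneous c H.

Definition almost_subset (A B : set nat) : Prop :=
  exists F : set nat, finite_set F /\ A `\` F `<=` B.

Definition ramsey_cohesive (R : nat -> cantor) (C : cantor) : Prop :=
  infinite_set [set n | almost_subset (elts C) (elts (R n)) \/
                        almost_subset (elts C) (~` elts (R n))].

Definition RCOH : problem :=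
  fun X C => infinite_set (elts C) /\ ramsey_cohesive (seq_nth X) C.

(* Main.v *)
(* Choose the colors c(n) recursively so that every finite intersection of the
   sets R_n^{c(n)} is infinite, where R^1 = R and R^0 is the complement of R.
   If H is homogeneous for c with color i, then the family (R_n^i : n in H) has
   all its finite intersections infinite and is computable from R (+) H, hence
   so is a pseudo-intersection of it, obtained greedily.  That set is almost
   contained in R_n^i for each of the infinitely many n in H. *)

Require Import Defs.
From mathcomp Require Import all_boot.
From mathcomp Require Import boolp classical_sets functions cardinality.
From Stdlib Require Cantor.

Set Implicit Arguments.
Unset Strict Implicit.
Unset Printing Implicit Defensive.

Local Open Scope classical_set_scope.

(** * Closure properties of the functions computable in an oracle *)

Definition computable (X : cantor) k (f : k.-tuple nat -> nat) : Prop :=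
  exists e : code k, forall v, eval X e v (f v).

(* An operation on numbers is computable when substituting computable functions of
   any common arity into it yields a computable function; this absorbs all
   shuffling of variables in codes. *)
Definition computable1 (X : cantor) (F : nat -> nat) : Prop :=
  forall k (f : k.-tuple nat -> nat), computable X f ->
    computable X (fun v => F (f v)).

Definition computable2 (X : cantor) (F : nat -> nat -> nat) : Prop :=
  forall k (f g : k.-tuple nat -> nat), computable X f -> computable X g ->
    computable X (fun v => F (f v) (g v)).

Definition computable3 (X : cantor) (F : nat -> nat -> nat -> nat) : Prop :=
  forall k (f g h : k.-tuple nat -> nat),
    computable X f -> computable X g -> computable X h ->
    computable X (fun v => F (f v) (g v) (h v)).

Lemma computable_comp X k m (F : m.-tuple nat -> nat)
    (f : 'I_m -> k.-tuple nat -> nat) :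
  computable X F -> (forall i, computable X (f i)) ->
  computable X (fun v => F [tuple f i v | i < m]).
Proof.
move=> [e eP] /choice[d dP]; exists (Comp e d) => v.
exists [tuple f i v | i < m]; split=> [i|]; last exact: eP.
by rewrite tnth_mktuple.
Qed.

Lemma computable_proj X k (i : 'I_k) : computable X (fun v => tnth v i).
Proof. by exists (Proj i). Qed.

Lemma computable1_code X (e : code 1) (F : nat -> nat) :
  (forall v, eval X e v (F (thead v))) -> computable1 X F.
Proof.
move=> eP k f cf.
have -> : (fun v => F (f v)) = (fun v => F (thead [tuple f v | _ < 1])).
  by apply/funext => v; rewrite /thead tnth_mktuple.
by apply: (computable_comp (F := fun w => F (thead w))); first by exists e.
Qed.

Lemma computable1_succ X : computable1 X succn.
Proof. exact: (computable1_code (e := Succ)). Qed.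

Lemma computable1_oracle X : computable1 X X.
Proof. exact: (computable1_code (e := Oracle)). Qed.

Lemma computable_const X k c : computable X (fun _ : k.-tuple nat => c).
Proof.
elim: c => [|c IHc]; first by exists (Zero k).
exact: computable1_succ IHc.
Qed.

Lemma computable1_const X c : computable1 X (fun=> c).
Proof. by move=> k f _; exact: computable_const. Qed.

Lemma computable1_id X : computable1 X id.
Proof. by []. Qed.

(** Stage, previous value, parameter is the order in which [Prec] feeds its step program. *)
Definition primrec (A : nat -> nat) (F : nat -> nat -> nat -> nat) (n p : nat) :=
  iteri n (fun i w => F i w p) (A p).

Lemma computable2_primrec X A F :
  computable1 X A -> computable3 X F -> computable2 X (primrec A F).
Proof.
move=> cA cF k f g cf cg.
(* Closure under substitution, applied to projections, yields the actual codes that [Prec] needs. *)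
have [a aP] := cA _ _ (computable_proj X (ord0 : 'I_1)).
have [e eP] := cF _ _ _ _ (computable_proj X (inord 0 : 'I_3))
  (computable_proj X (inord 1 : 'I_3)) (computable_proj X (inord 2 : 'I_3)).
have cR : computable X (fun v : 2.-tuple nat =>
    primrec A F (tnth v (inord 0)) (tnth v (inord 1))).
  exists (Prec a e) => v; exists (fun n => primrec A F n (tnth v (inord 1))).
  split=> [|i _|].
  - have := aP [tuple of behead v].
    by rewrite tnth_behead.
  - have := eP [tuple of [:: i, primrec A F i (tnth v (inord 1)) & behead v]].
    rewrite !(tnth_nth 0) !inordK //=.
    by rewrite nth_behead.
  - by congr primrec; congr tnth; apply: val_inj; rewrite /= inordK.
pose fg (i : 'I_2) := if i == 0 :> nat then f else g.
have cfg i : computable X (fg i) by rewrite /fg; case: ifP.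
have := computable_comp cR cfg; congr computable.
by apply/funext => v; rewrite !tnth_mktuple /fg !inordK.
Qed.

Lemma computable2_add X : computable2 X addn.
Proof.
have -> : addn = primrec id (fun _ w _ => w.+1).
  apply/funext => n; apply/funext => m; rewrite /primrec.
  by elim: n => //= n <-.
apply: computable2_primrec; first exact: computable1_id.
by move=> k f g h _ cg _; exact: computable1_succ.
Qed.

Lemma computable2_mul X : computable2 X muln.
Proof.
have -> : muln = primrec (fun=> 0) (fun _ w p => p + w).
  apply/funext => n; apply/funext => m; rewrite /primrec.
  by elim: n => //= n <-; rewrite mulSn.
apply: computable2_primrec; first exact: computable1_const.
by move=> k f g h _ cg ch; exact: computable2_add.
Qed.

Lemma computable1_eq0 X : computable1 X (fun n => n == 0).
Proof.
move=> k f cf.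
have -> : (fun v => nat_of_bool (f v == 0)) =
    (fun v => primrec (fun=> 1) (fun _ _ _ => 0) (f v) (f v)).
  by apply/funext => v; rewrite /primrec; case: (f v).
apply: computable2_primrec => //; first exact: computable1_const.
by move=> *; exact: computable_const.
Qed.

Lemma computable1_double X : computable1 X double.
Proof.
move=> k f cf; under eq_fun do rewrite -addnn.
exact: computable2_add.
Qed.

Lemma computable2_cantor X : computable2 X (fun n x => Cantor.to_nat (n, x)).
Proof.
move=> k f g cf cg.
(* Cantor's formula, by conversion: the recursion adds up 1, ..., [g v + f v]. *)
rewrite -[fun _ => _]/(fun v =>
  g v + primrec (fun=> 0) (fun i w _ => i.+1 + w) (g v + f v) 0).
apply: computable2_add => //.
apply: computable2_primrec; first exact: computable1_const.
- by move=> {}k {f cf} f {g cg} g h cf cg _; apply: computable2_add => //;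
    exact: computable1_succ.
- exact: computable2_add.
- exact: computable_const.
Qed.

Lemma computable1_joinr X Y : computable1 (join X Y) Y.
Proof.
move=> k f cf.
have -> : (fun v => nat_of_bool (Y (f v))) =
    (fun v => nat_of_bool (join X Y (f v).*2.+1)).
  by apply/funext => v; rewrite /join /= odd_double uphalf_double.
by apply: computable1_oracle; apply: computable1_succ; exact: computable1_double.
Qed.

Lemma computable2_joinl R Y :
  computable2 (join (seq_code R) Y) (fun n x => R n x).
Proof.
move=> k f g cf cg.
have -> : (fun v => nat_of_bool (R (f v) (g v))) = (fun v =>
    nat_of_bool (join (seq_code R) Y (Cantor.to_nat (f v, g v)).*2)).
  apply/funext => v; rewrite /join odd_double doubleK /seq_code.
  by rewrite Cantor.cancel_of_to.
apply: computable1_oracle; apply: computable1_double.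
exact: computable2_cantor.
Qed.

(* The greedy pseudo-intersection of the sets {x | R n x = i}, n in H: a number
   enters when it lies in all of those with index at most the number of
   elements that entered before it. *)
Definition fits (R : nat -> cantor) (H : cantor) (i : bool) (k x : nat) : bool :=
  all (fun n => H n ==> (R n x == i)) (iota 0 k.+1).

Fixpoint greedy_count R H i (x : nat) : nat :=
  if x is y.+1 then greedy_count R H i y + fits R H i (greedy_count R H i y) y
  else 0.

Definition greedy R H i : cantor :=
  fun x => fits R H i (greedy_count R H i x) x.

Lemma computable2_fits R H i :
  computable2 (join (seq_code R) H) (fun k x => fits R H i k x).
Proof.
move=> k f g cf cg.
(* The bounded conjunction is a product of truth values; a factor vanishes exactly when [n] is in
   [H] and [R n x] differs from [i]. The bit [i] is fixed, so the program may depend on it. *)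
have -> : (fun v => nat_of_bool (fits R H i (f v) (g v))) = (fun v =>
    primrec (fun=> 1)
      (fun n w x => w * (H n * (if i then R n x == 0 :> nat else R n x) == 0))
      (f v).+1 (g v)).
  apply/funext => v; rewrite /primrec /fits; elim: (f v).+1 => // n IHn.
  rewrite -addn1 iotaD all_cat -mulnb IHn addn1 /=; congr muln.
  by case: i {IHn}; case: (H n); case: (R n (g v)).
apply: computable2_primrec => //; first exact: computable1_const.
  move=> m a b c ca cb cc; apply: computable2_mul => //; apply: computable1_eq0.
  apply: computable2_mul; first exact: computable1_joinr.
  by case: i; [apply: computable1_eq0|]; exact: computable2_joinl.
exact: computable1_succ.
Qed.

Lemma computes_greedy R H i : computes (join (seq_code R) H) (greedy R H i).
Proof.
pose X := join (seq_code R) H.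
have cC : computable1 X (greedy_count R H i).
  move=> k f cf.
  have -> : (fun v => greedy_count R H i (f v)) = (fun v =>
      primrec (fun=> 0) (fun x w _ => w + fits R H i w x) (f v) 0).
    by apply/funext => v; rewrite /primrec; elim: (f v) => //= n ->.
  apply: computable2_primrec => //; first exact: computable1_const.
    move=> m a b c ca cb _; apply: computable2_add => //.
    exact: computable2_fits.
  exact: computable_const.
have cx := computable_proj X (ord0 : 'I_1).
have [e eP] := @computable2_fits R H i _ _ _ (cC _ _ cx) cx.
by exists e => n; have := eP [tuple n].
Qed.

Lemma infinite_nat_unbounded (A : set nat) :
  infinite_set A <-> forall m, exists2 x, m <= x & A x.
Proof.
split=> [infA m|ubA /finite_seqP[s sA]].
  apply: contrapT => noA; apply: infA; apply: (sub_finite_set _ (finite_II m)).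
  by move=> x Ax /=; rewrite ltnNge; apply/negP => mx; apply: noA; exists x.
have [x lx] := ubA (\max_(y <- s) y).+1; rewrite sA /= => xs.
by have := @leq_bigmax_seq _ s xpredT id _ xs isT; rewrite leqNgt lx.
Qed.

(** If nothing entered from [m] on, the count would freeze at its value at [m]; but infinitely many
    numbers fit that level, and one of them beyond [m] would enter. *)
Lemma greedy_infinite R H i :
  (forall k, infinite_set [set x | fits R H i k x]) ->
  infinite_set (elts (greedy R H i)).
Proof.
move=> fits_inf; apply/infinite_nat_unbounded => m; apply: contrapT => noC.
have cntE x : m <= x -> greedy_count R H i x = greedy_count R H i m.
  elim: x => [|x IHx]; first by rewrite leqn0 => /eqP ->.
  rewrite leq_eqVlt => /predU1P[->//|]; rewrite ltnS => mx /=.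
  rewrite -/(greedy R H i x) (negbTE (_ : ~~ greedy R H i x)) ?addn0 ?IHx //.
  by apply/negP => Cx; apply: noC; exists x.
have /infinite_nat_unbounded/(_ m)[x mx fx] :=
  fits_inf (greedy_count R H i m).
by apply: noC; exists x => //; rewrite /elts /= /greedy cntE.
Qed.

(** Each new element raises the count, so it eventually stays at least [n]; from then on every
    element that enters has passed the test for index [n]. *)
Lemma greedy_almost_subset R H i n :
  infinite_set (elts (greedy R H i)) -> H n ->
  almost_subset (elts (greedy R H i)) [set x | R n x = i].
Proof.
move=> infC Hn.
have [m mP] : exists m, forall x, m <= x -> n <= greedy_count R H i x.
  have mono x d : greedy_count R H i x <= greedy_count R H i (x + d).
    elim: d => [|d IHd]; first by rewrite addn0.
    by rewrite addnS; exact: leq_trans (leq_addr _ _).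
  suff [m mP] : exists m, n <= greedy_count R H i m.
    by exists m => x /subnKC <-; exact: leq_trans (mono _ _).
  elim: n {Hn} => [|n [m nm]]; first by exists 0.
  have /infinite_nat_unbounded/(_ m)[x /subnKC mx Cx] := infC.
  exists x.+1; rewrite /= -/(greedy R H i x) [greedy R H i x]Cx addn1 ltnS.
  by rewrite -mx; exact: leq_trans (mono _ _).
exists `I_m; split=> // x [Cx /negP]; rewrite -leqNgt => /mP nx.
have /allP/(_ n) := Cx; rewrite mem_iota ltnS nx Hn => /(_ isT) /eqP.
exact.
Qed.

(** * A coloring whose finite intersections are infinite *)

(** The intersection of the R_m^{c(m)} for m < n, where c(m) = 1 whenever this keeps it infinite.
    The choice is a classical truth value: c need not be computable from [R]. *)
Fixpoint nested (R : nat -> cantor) (n : nat) : set nat :=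
  if n is m.+1 then
    [set x | nested R m x /\
       R m x = `[< infinite_set [set y | nested R m y /\ R m y] >]]
  else setT.

Definition nested_color (R : nat -> cantor) : nat -> bool :=
  fun n => `[< infinite_set [set y | nested R n y /\ R n y] >].

Lemma infinite_bool_split (A : set nat) (f : nat -> bool) :
  infinite_set A -> ~ infinite_set [set x | A x /\ f x] ->
  infinite_set [set x | A x /\ f x = false].
Proof.
move=> infA /contrapT fin1 fin0; apply: infA.
have /sub_finite_set : A `<=` [set x | A x /\ f x] `|` [set x | A x /\ f x = false].
  by move=> x Ax; case fx: (f x); [left|right]; split.
by apply; rewrite finite_setU.
Qed.

(** Color 0 is taken only when the half of color 1 is finite, and then the other half is
    infinite. *)
Lemma nested_infinite R n : infinite_set (nested R n).
Proof.
elim: n => [|n IHn] /=; first exact: infinite_nat.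
by case: asboolP => // /(infinite_bool_split IHn).
Qed.

Lemma nested_colorE R n x m :
  nested R n x -> m < n -> R m x = nested_color R m.
Proof.
elim: n => // n IHn [nx Rx]; rewrite ltnS leq_eqVlt => /predU1P[->//|].
exact: IHn.
Qed.

(** Pigeonhole: one of the two color classes is infinite. *)
Lemma RT12_instance c : is_instance RT12 c.
Proof.
have [infc|finc] := pselect (infinite_set [set x | setT x /\ c x]).
  exists c; split; last by exists true.
  by apply: contra_not infc; apply: sub_finite_set => x [].
exists (fun x => ~~ c x); split; last by exists false => x /negbTE.
have := infinite_bool_split infinite_nat finc; apply: contra_not.
by apply: sub_finite_set => x [_ /negbT].
Qed.

Lemma homogeneous_nested_color R H :
  infinite_set (elts H) -> homogeneous (nested_color R) H ->
  exists C : cantor,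
    [/\ computes (join (seq_code R) H) C,
        infinite_set (elts C) & ramsey_cohesive R C].
Proof.
move=> infH [i Hi]; exists (greedy R H i).
have infC : infinite_set (elts (greedy R H i)).
  (* Level [k] tests the indices up to [k], hence [k.+1]; those in [H] have color [i], so all of
     [nested R k.+1] fits. *)
  apply: greedy_infinite => k; have := @nested_infinite R k.+1.
  apply: contra_not; apply: sub_finite_set => x kx; apply/allP => n.
  rewrite mem_iota => /= nk; apply/implyP => /Hi <-.
  by rewrite (nested_colorE kx nk).
split=> //; first exact: computes_greedy.
(* Every index in the infinite set [H] witnesses cohesiveness; the color [i] decides on which
   side. *)
apply: contra_not infH; apply: sub_finite_set => n Hn.
have := greedy_almost_subset infC Hn.
case: i {Hi infC} => - [F [finF CF]]; [left|right]; exists F; split=> // x.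
by move=> /CF /= Rx; apply/negP; rewrite Rx.
Qed.

Theorem theorem2p5 :
  omnisciently_computably_reducible RCOH RT12 /\
  forall R : nat -> cantor, exists c : nat -> bool,
    forall H : cantor, infinite_set (elts H) -> homogeneous c H ->
      exists C : cantor,
        [/\ computes (join (seq_code R) H) C,
            infinite_set (elts C) & ramsey_cohesive R C].
Proof.
split=> [X _|R]; last first.
  by exists (nested_color R) => H; exact: homogeneous_nested_color.
exists (nested_color (seq_nth X)); split; first exact: RT12_instance.
move=> H [infH homH].
have [C [cC infC cohC]] := homogeneous_nested_color infH homH.
by exists C; split=> //; rewrite seq_nthK in cC.
Qed.
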